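(* Let $(X,p)$ be a partial metric space, let $r\ge 0$ be a real number, and let $\{x_n\}$ be an $r$-statistically convergent sequence in $X$ (that is, $r$-statistically convergent to some point of $X$). Then $st\text{-}LIM^{r}x_n$ is a closed subset of $X$.
   Context: A partial metric on a nonempty set $X$ is a function $p:X\times X\to[0,\infty)$ such that for all $x,y,z\in X$: (p1) $0\le p(x,x)\le p(x,y)$; (p2) $x=y$ if and only if $p(x,x)=p(x,y)=p(y,y)$; (p3) $p(x,y)=p(y,x)$; (p4) $p(x,y)\le p(x,z)+p(z,y)-p(z,z)$. The pair $(X,p)$ is called a partial metric space. Its topology is the one having as a base the open balls $B^{p}_{\rho}(x)=\{y\in X:p(x,y)<p(x,x)+\rho\}$, $x\in X$, $\rho>0$; ''closed'' refers to this topology. For $B\subset\mathbb N$, the natural density is $d(B)=\lim_{n\to\infty}\frac{|\{k\in B:k\le n\}|}{n}$, if the limit exists. For a real number $r\ge 0$, a sequence $\{x_n\}$ in $X$ is $r$-statistically convergent to $x\in X$ if for every $\varepsilon>0$, $d(\{n\in\mathbb N:|p(x_n,x)-p(x,x)|\ge r+\varepsilon\})=0$. The $r$-st limit set $st\text{-}LIM^{r}x_n$ is the set of all $x\in X$ such that $\{x_n\}$ is $r$-statistically convergent to $x$. *)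

(* Defs.v *)
From HB Require Import structures.
From mathcomp Require Import all_boot all_order all_algebra finmap.
From mathcomp Require Import all_classical all_reals all_analysis.
From mathcomp Require Import lra.

Set Implicit Arguments.
Unset Strict Implicit.
Unset Printing Implicit Defensive.

Import Order.TTheory GRing.Theory Num.Theory.
Import numFieldNormedType.Exports.

Local Open Scope classical_set_scope.
Local Open Scope ring_scope.

Record partial_metric (R : realType) (X : Type) := PartialMetric {
  pm_fun :> X -> X -> R ;
  pm_nonempty : [set: X] !=set0 ;
  pm_small_self : forall x y, 0 <= pm_fun x x /\ pm_fun x x <= pm_fun x y ;
  pm_eq : forall x y,
    x = y <-> pm_fun x x = pm_fun x y /\ pm_fun x y = pm_fun y y ;
  pm_sym : forall x y, pm_fun x y = pm_fun y x ;
  pm_triangle : forall x y z,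
    pm_fun x y <= pm_fun x z + pm_fun z y - pm_fun z z }.

Definition pm_ball (R : realType) (X : Type) (p : partial_metric R X)
  (x : X) (rho : R) : set X := [set y | p x y < p x x + rho].

Definition pm_balls (R : realType) (X : Type) (p : partial_metric R X) :
  set (set X) := [set B | exists x rho, 0 < rho /\ B = pm_ball p x rho].

Lemma pm_ball_center (R : realType) (X : Type) (p : partial_metric R X)
  (x : X) (rho : R) : 0 < rho -> pm_ball p x rho x.
Proof. by move=> rho0; rewrite /pm_ball /= ltrDl. Qed.

Lemma pm_ball_sub (R : realType) (X : Type) (p : partial_metric R X)
    (x y : X) (rho : R) : pm_ball p x rho y ->
  exists2 d : R, 0 < d &
    forall d', d' <= d -> pm_ball p y d' `<=` pm_ball p x rho.
Proof.
rewrite /pm_ball /= => xy; exists (p x x + rho - p x y); first lra.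
move=> d' d'd z /= yz; have := pm_triangle p x z y; lra.
Qed.

Lemma pm_balls_cover (R : realType) (X : Type) (p : partial_metric R X) :
  \bigcup_(B in pm_balls p) B = [set: X].
Proof.
rewrite -subTset => x _; exists (pm_ball p x 1); last exact: pm_ball_center.
by exists x, 1.
Qed.

Lemma pm_balls_join (R : realType) (X : Type) (p : partial_metric R X)
    (A B : set X) (t : X) : pm_balls p A -> pm_balls p B -> A t -> B t ->
  exists C, [/\ pm_balls p C, C t & C `<=` A `&` B].
Proof.
move=> [x [a [_ ->]]] [y [b [_ ->]]].
move=> xt yt; have [d d0 dA] := pm_ball_sub xt.
have [e e0 eB] := pm_ball_sub yt.
have m0 : 0 < Num.min d e by rewrite lt_min d0.
exists (pm_ball p t (Num.min d e)); split.
- by exists t, (Num.min d e).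
- exact: pm_ball_center.
- by rewrite subsetI; split; [apply: dA|apply: eB]; rewrite ge_min lexx ?orbT.
Qed.

(* X as the topological space whose topology has the open balls of p as a
   base; a copy of X, so that the topology is found from p. *)
Definition pm_space (R : realType) (X : Type) (p : partial_metric R X) : Type :=
  X.

HB.instance Definition _ (R : realType) (X : Type) (p : partial_metric R X) :=
  gen_eqMixin (pm_space p).
HB.instance Definition _ (R : realType) (X : Type) (p : partial_metric R X) :=
  gen_choiceMixin (pm_space p).
HB.instance Definition _ (R : realType) (X : Type) (p : partial_metric R X) :=
  @isBaseTopological.Build (pm_space p) (set (pm_space p)) (pm_balls p) id
    (pm_balls_cover p) (@pm_balls_join R X p).

Lemma pm_balls_basis (R : realType) (X : Type) (p : partial_metric R X) :
  basis (pm_balls p : set (set (pm_space p))).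
Proof.
split=> [B pB|x U].
  by exists [set B]; [move=> C /= ->|rewrite bigcup_set1].
rewrite nbhsE => -[V [[D sD <-] [B DB Bx]] VU].
exists B; first by split=> //; exact: sD.
by move=> y By; apply: VU; exists B.
Qed.

(* Natural density on {1, 2, ...}: 0 is never counted, so the value at 0 of a
   sequence is irrelevant below. *)
Definition has_density (R : realType) (B : set nat) (l : R) : Prop :=
  (fun n : nat =>
     #|` fset_set [set k | B k /\ (0 < k <= n)%N]|%:R / n%:R : R) @ \oo --> l.

Definition r_stat_cvg (R : realType) (X : Type) (p : partial_metric R X)
    (r : R) (x : nat -> X) (a : X) : Prop :=
  forall eps : R, 0 < eps ->
    has_density [set n | r + eps <= `|p (x n) a - p a a|] (0 : R).

Definition st_LIM (R : realType) (X : Type) (p : partial_metric R X)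
    (r : R) (x : nat -> X) : set X := [set a | r_stat_cvg p r x a].

(* Main.v *)
(* If y lies in the limit set and p a y < p a a + eps / 2, then
   p (x n) a - p a a <= (p (x n) y - p y y) + (p a y - p a a) by the triangle
   inequality, so the indices bad for (a, eps) are bad for (y, eps / 2). The
   self-distances p y y need not approach p a a: they cancel. *)
Require Import Defs.
From mathcomp Require Import all_boot all_order all_algebra finmap.
From mathcomp Require Import all_classical all_reals all_analysis.
From mathcomp Require Import lra.

Import Order.TTheory GRing.Theory Num.Theory.
Import numFieldNormedType.Exports.

Local Open Scope classical_set_scope.
Local Open Scope ring_scope.

Lemma has_density0_subset (R : realType) (A B : set nat) :
  A `<=` B -> has_density B (0 : R) -> has_density A (0 : R).
Proof.
move=> AB; apply: (squeeze_cvgr _ (cvg_cst 0)); apply: nearW => n.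
(* [fset_set] returns the empty set on infinite sets, so comparing the two counts requires
   finiteness. *)
have fin C : finite_set [set k | C k /\ (0 < k <= n)%N].
  by apply: (sub_finite_set _ (finite_II n.+1)) => k /= [_ /andP[]].
(* Also valid at [n = 0], where [n%:R^-1] is [0]. *)
rewrite divr_ge0 ?ler0n//= ler_wpM2r ?invr_ge0 ?ler0n// ler_nat.
apply: fsubset_leq_card; rewrite -fset_set_sub//.
by move=> k /= [Ak kn]; split=> //; exact: AB.
Qed.

(** Self-distances are minimal by (p1) and symmetry. Removing the absolute values leaves the final
    estimate linear in the values of [p]. *)
Lemma pm_dist_self (R : realType) (X : Type) (p : partial_metric R X)
  (x y : X) : `|p x y - p y y| = p x y - p y y.
Proof. by rewrite ger0_norm// subr_ge0 pm_sym; case: (pm_small_self p y x). Qed.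

Lemma pm_ball_nbhs (R : realType) (X : Type) (p : partial_metric R X)
  (a : pm_space p) (rho : R) : 0 < rho -> nbhs a (pm_ball p a rho).
Proof.
move=> rho0; apply: open_nbhs_nbhs; split; last exact: pm_ball_center.
by apply: (pm_balls_basis p).1; exists a, rho.
Qed.

Theorem corollary2p1 (R : realType) (X : Type) (p : partial_metric R X)
  (r : R) (hr : 0 <= r) (x : nat -> X)
  (hx : exists a : X, r_stat_cvg p r x a) :
  closed (st_LIM p r x : set (pm_space p)).
Proof.
move=> a cla eps eps0.
have e2 : 0 < eps / 2 by rewrite divr_gt0.
have [y [Ly]] := cla _ (pm_ball_nbhs _ _ p a _ e2).
rewrite /pm_ball /= => ay.
apply: has_density0_subset (Ly _ e2) => n /=; rewrite !pm_dist_self.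
by have := pm_triangle p (x n) a y; rewrite (pm_sym p y a); lra.
Qed.
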